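(* Let $\mathcal{P}$ be a finite poset and $\mathcal{D}_\mathcal{P}$ its downset lattice. Then $\mathrm{led}(\mathcal{D}_\mathcal{P})$ is at most one quarter of the number of ordered pairs $(A,B)$ of antichains of $\mathcal{P}$ such that the subposet $\mathcal{P}[A\triangle B]$ induced by $A\triangle B$ has at least two connected components.
   Context: $\mathcal{D}_\mathcal{P}$ is the poset of all downsets of $\mathcal{P}$ ordered by inclusion. The distance between two linear extensions of a finite poset is the number of unordered pairs of elements appearing in different orders in them; $\mathrm{led}$ denotes the linear extension diameter, the maximum such distance. Connected components are those of the comparability graph. *)

(* Defs.v *)
From HB Require Import structures.
From mathcomp Require Import all_boot all_order.

Set Implicit Arguments.
Unset Strict Implicit.
Unset Printing Implicit Defensive.

Import Order.TTheory.

Section Downsets.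
Variables (d : Order.disp_t) (P : finPOrderType d).

Definition is_downset (S : {set P}) : bool :=
  [forall x : P, forall y in S, (x <= y)%O ==> (x \in S)].

Record downset := Downset {
  downset_set :> {set P};
  _ : is_downset downset_set
}.

HB.instance Definition _ := [isSub for downset_set].
HB.instance Definition _ := [Finite of downset by <:].

Definition downset_le : rel downset := fun X Y => X \subset Y.

Fact downset_le_refl : reflexive downset_le.
Proof. by move=> X; apply: subxx. Qed.

Fact downset_le_anti : antisymmetric downset_le.
Proof.
by move=> X Y XYX; apply: val_inj; apply/eqP; rewrite eqEsubset; apply: XYX.
Qed.

Fact downset_le_trans : transitive downset_le.
Proof. by move=> Y X Z; apply: subset_trans. Qed.

HB.instance Definition _ :=
  Order.Le_isPOrder.Build Order.SetSubsetOrder.subset_display downset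
    downset_le_refl downset_le_anti downset_le_trans.

End Downsets.

Section LinearExtensions.
Variables (d : Order.disp_t) (T : finPOrderType d).

(* A linear extension is encoded by its position function: f x is the position
   of x in the list of all elements of T. *)
Definition is_linear_extension (f : {ffun T -> 'I_#|T|}) : bool :=
  injectiveb f && [forall x : T, forall y : T, (x <= y)%O ==> (f x <= f y)%N].

Definition linext_dist (f g : {ffun T -> 'I_#|T|}) : nat :=
  #|[set E : {set T} | [exists x, exists y,
       [&& E == [set x; y], (f x < f y)%N & (g y < g x)%N]]]|.

Definition led : nat :=
  \max_(f | is_linear_extension f) \max_(g | is_linear_extension g)
    linext_dist f g.

End LinearExtensions.

Section Antichains.
Variables (d : Order.disp_t) (P : finPOrderType d).

Definition is_antichain (A : {set P}) : bool :=
  [forall x in A, forall y in A, (x <= y)%O ==> (x == y)].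

Definition symdiff (A B : {set P}) : {set P} := (A :\: B) :|: (B :\: A).

(* Adjacency of the comparability graph of the subposet induced by S, seen as a
   relation on P. S is closed under it, so n_comp below counts exactly the
   components of that graph (points outside S are not counted). *)
Definition induced_comparability (S : {set P}) : rel P :=
  [rel x y | [&& x \in S, y \in S & (x >=< y)%O]].

Definition num_components (S : {set P}) : nat :=
  n_comp (induced_comparability S) S.

End Antichains.

Arguments downset {d} P.
Arguments led {d} T.

(* Main.v *)
Require Import Defs.
From HB Require Import structures.
From mathcomp Require Import all_boot all_order.
From mathcomp Require Import zify.

(** Identify downsets with antichains and sort the pairs [(A, B)] of antichains
    by [(A :&: B, A △ B)].  Inside a component of [P[A △ B]] one of [A], [B]
    consists of the minimal elements and the other one of the maximal elements,
    and swapping the two inside any component gives a pair of the same class.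
    So a class is the set of complementary pairs of a cube [2^k], where [k] is
    the number of components and the cube is mapped monotonically into the
    downset lattice.  The members [X] of the cube that precede their complement
    in one linear extension but follow it in the other form the intersection of
    a down-closed and an up-closed family, each with at most half of the [2^k]
    members; by the Harris-Kleitman inequality there are at most [2^k / 4]. *)

Import Order.TTheory.

Set Implicit Arguments.
Unset Strict Implicit.
Unset Printing Implicit Defensive.

(** * Correlation of up-closed and down-closed families in a cube *)

Section HarrisKleitman.
Variable T : finType.
Implicit Types (A B X : {set T}) (p u v : pred {set T}).

Lemma card_subsetsU1 x X p : x \notin X ->
  #|[set A in powerset (x |: X) | p A]| =
    #|[set A in powerset X | p A]| + #|[set A in powerset X | p (x |: A)]|.
Proof.
move=> xX; rewrite -(cardsID [set A : {set T} | x \in A]) addnC; congr (_ + _).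
  apply: eq_card => A; rewrite !inE.
  case: (boolP (x \in A)) => xA //=.
    by apply/esym/negbTE/negP => /andP[/subsetP/(_ _ xA)]; rewrite (negbTE xX).
  have Ax : A :\ x = A by apply/setDidPl; rewrite disjoint_sym disjoints1.
  by rewrite -subDset Ax.
rewrite -[RHS](@card_in_imset _ _ (fun A => x |: A)) => [|A B]; last first.
  rewrite !inE => /andP[sA _] /andP[sB _] /(congr1 (fun A => A :\ x)).
  by rewrite /= !setU1K ?(contraNN (subsetP sA x) xX) ?(contraNN (subsetP sB x) xX).
apply: eq_card => A; rewrite !inE; apply/idP/imsetP.
  case/andP=> /andP[sA pA] xA; exists (A :\ x); last by rewrite setD1K.
  by rewrite !inE setD1K // pA andbT subDset.
case=> B; rewrite !inE => /andP[sB pB] ->.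
by rewrite pB setUS // setU11.
Qed.

(** Induction on [#|X|]: an element [x] splits the cube into two half-cubes, and on either half [u]
    and [v] restrict to monotone predicates of the same kind. *)
Lemma harris_kleitman X u v :
    (forall A B, A \subset B -> u A -> u B) ->
    (forall A B, A \subset B -> v B -> v A) ->
  2 ^ #|X| * #|[set A in powerset X | u A && v A]| <=
    #|[set A in powerset X | u A]| * #|[set A in powerset X | v A]|.
Proof.
move: {2}#|X| (erefl #|X|) => n; elim: n X u v => [|n IH] X u v cX uup vdn.
  have p0 p : #|[set A in powerset X | p A]| = p set0.
    move/eqP: cX; rewrite cards_eq0 => /eqP ->; rewrite powerset0.
    case: (boolP (p set0)) => p0.
      rewrite -[RHS](cards1 (set0 : {set T})); apply: eq_card => A.
      by rewrite !inE; case: eqP => // ->.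
    by apply: eq_card0 => A; rewrite !inE; case: eqP => // ->; apply: negbTE.
  by rewrite !p0 cX; case: (u set0); case: (v set0).
have /card_gt0P[x xX] : 0 < #|X| by rewrite cX.
have xX' : x \notin X :\ x by rewrite !inE eqxx.
have cX' : #|X :\ x| = n by move: (cardsD1 x X); rewrite xX cX => -[].
have IH0 := IH _ _ _ cX' uup vdn.
have := IH _ (fun A => u (x |: A)) (fun A => v (x |: A)) cX'.
move=> /(_ (fun A B s => uup _ _ (setUS _ s)) (fun A B s => vdn _ _ (setUS _ s))).
have le_card p (q : pred {set T}) : (forall A, p A -> q A) ->
    #|[set A in powerset (X :\ x) | p A]| <= #|[set A in powerset (X :\ x) | q A]|.
  move=> pq; apply/subset_leq_card/subsetP => A; rewrite !inE => /andP[->] /=.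
  exact: pq.
have := le_card _ _ (fun A => uup _ _ (subsetUr [set x] A)).
have := le_card _ _ (fun A => vdn _ _ (subsetUr [set x] A)).
have cardX p := card_subsetsU1 p xX'.
rewrite setD1K // in cardX; rewrite !cardX cX expnS.
move: IH0; rewrite cX' /=.
(* Chebyshev's sum inequality for the two halves of the cube: the count of [u]
   increases and the count of [v] decreases from the first to the second. *)
set N := 2 ^ n.
by nia.
Qed.

(** Complementation in [X] is injective and carries the family to a disjoint family of the same
    size. *)
Lemma card_complement_free X p :
    (forall A, A \subset X -> p A -> ~~ p (X :\: A)) ->
  2 * #|[set A in powerset X | p A]| <= 2 ^ #|X|.
Proof.
move=> pC; rewrite -card_powerset mul2n -addnn.
set F := [set A in _ | _].
have -> : #|F| + #|F| = #|F| + #|[set X :\: A | A in F]|.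
  congr (_ + _); rewrite card_in_imset // => A B.
  rewrite !inE => /andP[sA _] /andP[sB _] /(congr1 (setD X)).
  by rewrite !setDDr !setDv !set0U (setIidPr sA) (setIidPr sB).
rewrite -cardsUI [X in _ + X](_ : _ = 0) ?addn0.
  apply/subset_leq_card/subsetP => A; rewrite !inE => /orP[/andP[]//|].
  by case/imsetP => B _ ->; apply: subsetDl.
apply: eq_card0 => A; rewrite !inE; apply/negP => /andP[/andP[_ pA]].
case/imsetP => B; rewrite !inE => /andP[sB pB] eA.
by move: (pC _ sB pB); rewrite -eA pA.
Qed.

(** Each family fills at most half of the cube, so negative correlation leaves at most a quarter for
    their intersection. *)
Lemma card_up_down_complement_free X u v :
    (forall A B, A \subset B -> u A -> u B) ->
    (forall A B, A \subset B -> v B -> v A) ->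
    (forall A, A \subset X -> u A -> ~~ u (X :\: A)) ->
    (forall A, A \subset X -> v A -> ~~ v (X :\: A)) ->
  4 * #|[set A in powerset X | u A && v A]| <= 2 ^ #|X|.
Proof.
move=> uup vdn /card_complement_free uC /card_complement_free vC.
have := harris_kleitman X uup vdn.
have : 0 < 2 ^ #|X| by rewrite expn_gt0.
move: uC vC; set N := 2 ^ #|X|; set a := #|_|; set b := #|_|; set c := #|_|.
move=> ua vb N0 Nc; rewrite -(leq_pmul2l N0).
have := leq_mul ua vb; nia.
Qed.

End HarrisKleitman.

(** * Downsets as down-closures of antichains *)

Section AntichainDownset.
Variables (d : Order.disp_t) (P : finPOrderType d).
Implicit Types (A B S : {set P}) (x y z : P).

Definition down_closure A : {set P} := [set x | [exists y in A, (x <= y)%O]].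

Lemma down_closureP A x :
  reflect (exists2 y, y \in A & (x <= y)%O) (x \in down_closure A).
Proof. by rewrite inE; apply: exists_inP. Qed.

Fact down_closure_is_downset A : is_downset (down_closure A).
Proof.
apply/forallP => x; apply/forall_inP => y /down_closureP[z zA yz].
by apply/implyP => xy; apply/down_closureP; exists z => //; apply: le_trans yz.
Qed.

Definition downset_of A : downset P := Downset (down_closure_is_downset A).

Lemma antichainP A :
  reflect {in A &, forall x y, (x <= y)%O -> x = y} (is_antichain A).
Proof.
apply: (iffP forall_inP) => [h x y xA yA xy|h x xA].
  by move: (h x xA) => /forall_inP/(_ y yA)/implyP/(_ xy)/eqP.
by apply/forall_inP => y yA; apply/implyP => /(h _ _ xA yA) ->.
Qed.

Lemma downset_of_antichain (X : downset P) :
  exists2 A, is_antichain A & downset_of A = X.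
Proof.
pose A := [set x in downset_set X |
  [forall y in downset_set X, (x <= y)%O ==> (x == y)]].
exists A.
  apply/antichainP => x y; rewrite !inE => /andP[_ /forall_inP hx] /andP[yX _].
  by move=> xy; apply/eqP; move: (hx y yX); rewrite xy.
have /forallP dX : is_downset (downset_set X) by case: X {A}.
apply: val_inj; apply/setP => x; apply/down_closureP/idP => /= [[y]|xX].
  rewrite inE => /andP[yX _] xy.
  by move: (dX x) => /forall_inP/(_ y yX); rewrite xy.
have Px : [pred z | (z \in downset_set X) && (x <= z)%O] x by rewrite /= xX lexx.
(* A maximal element of [X] above [x] is found by maximizing the size of the principal downset,
   which grows strictly along [<]. *)
case: (arg_maxnP (fun z : P => #|[set w : P | (w <= z)%O]|) Px).
move=> m /= /andP[mX xm] mmax; exists m => //; rewrite inE mX /=.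
apply/forall_inP => y yX; apply/implyP => my; apply/negPn/negP => nmy.
have /mmax : (y \in downset_set X) && (x <= y)%O by rewrite yX (le_trans xm).
apply/negP; rewrite -ltnNge; apply/proper_card/properP; split.
  by apply/subsetP => w; rewrite !inE => /le_trans; apply.
exists y; rewrite !inE ?lexx //; apply/negP => ym.
by case/negP: nmy; apply/eqP/le_anti; rewrite my.
Qed.

Lemma linext_mono (f : {ffun downset P -> 'I_#|{: downset P}|}) (X Y : downset P) :
  is_linear_extension f -> downset_set X \subset downset_set Y -> f X <= f Y.
Proof. by case/andP=> _ /forallP/(_ X)/forallP/(_ Y)/implyP; apply. Qed.

Definition reversed_pairs (f g : {ffun downset P -> 'I_#|{: downset P}|}) :=
  [set AB : {set P} * {set P} |
    [&& is_antichain AB.1, is_antichain AB.2,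
        f (downset_of AB.1) < f (downset_of AB.2) &
        g (downset_of AB.2) < g (downset_of AB.1)]].

(** Every reversed pair of downsets is the image under [E] of a pair of generating antichains,
    listed in the order of [f]. *)
Lemma linext_dist_reversed_pairs f g :
  linext_dist f g <= #|reversed_pairs f g|.
Proof.
pose E (AB : {set P} * {set P}) := [set downset_of AB.1; downset_of AB.2].
apply: leq_trans (leq_imset_card E _); apply/subset_leq_card/subsetP => D.
rewrite inE => /existsP[X /existsP[Y /and3P[/eqP-> ltf ltg]]].
have [A acA eA] := downset_of_antichain X.
have [B acB eB] := downset_of_antichain Y.
apply/imsetP; exists (A, B); last by rewrite /E /= eA eB.
by rewrite inE /= acA acB eA eB ltf ltg.
Qed.

(** * Components of the induced comparability graph *)

Lemma induced_comparability_sym S : symmetric (induced_comparability S).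
Proof. by move=> x y; rewrite /induced_comparability /= andbCA comparable_sym. Qed.

Lemma connect_induced_sym S : connect_sym (induced_comparability S).
Proof. exact/sym_connect_sym/induced_comparability_sym. Qed.

Lemma closed_induced_comparability S (a : {pred P}) :
    {in S &, forall x y, (x < y)%O -> (x \in a) = (y \in a)} ->
  closed (induced_comparability S) a.
Proof.
move=> h x y /and3P[xS yS]; rewrite /Order.comparable !le_eqVlt.
case/orP => /predU1P[->//|lt]; first exact: h.
by apply/esym/h.
Qed.

Definition component_roots S : {set P} :=
  [set x in S | root (induced_comparability S) x == x].

Lemma num_components_roots S : num_components S = #|component_roots S|.
Proof. by apply: eq_card => x; rewrite !inE andbC. Qed.

Lemma root_component_roots S x :
  x \in S -> root (induced_comparability S) x \in component_roots S.
Proof.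
move=> xS; rewrite inE -(closed_connect _ (connect_root _ x)) ?xS.
  exact: (roots_root (connect_induced_sym S)).
by apply: closed_induced_comparability => y z yS zS _; rewrite yS zS.
Qed.

Lemma root_lt S x y : x \in S -> y \in S -> (x < y)%O ->
  root (induced_comparability S) x = root (induced_comparability S) y.
Proof.
move=> xS yS /ltW xy; apply/rootP; first exact: connect_induced_sym.
by apply: connect1; rewrite /induced_comparability /= xS yS /Order.comparable xy.
Qed.

Definition top S : {set P} := [set x in S | ~~ [exists y in S, (x < y)%O]].

(* The antichain with common part [I] that takes, in the components of [S]
   with root in [T], the maximal elements and in the others the
   non-maximal ones (none for a singleton component). *)
Definition cube_antichain (I S T : {set P}) : {set P} :=
  I :|: [set x in S | (x \in top S) == (root (induced_comparability S) x \in T)].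

Definition pair_class (AB : {set P} * {set P}) :=
  (AB.1 :&: AB.2, symdiff AB.1 AB.2).

Lemma in_cube_antichain I S T x :
  (x \in cube_antichain I S T) = (x \in I) || (x \in S) &&
    ((x \in top S) == (root (induced_comparability S) x \in T)).
Proof. by rewrite in_setU in_set. Qed.

(** Only membership of roots in [T] is ever tested, so the complement within the roots, used for
    counting, and the absolute complement are interchangeable. *)
Lemma cube_antichain_setD I S T :
  cube_antichain I S (component_roots S :\: T) = cube_antichain I S (~: T).
Proof.
apply/setP => x; rewrite !in_cube_antichain; congr (_ || _).
case: (boolP (x \in S)) => //= xS.
by rewrite in_setD in_setC root_component_roots // andbT.
Qed.

Lemma cube_antichain_setCD I S T :
  cube_antichain I S (~: (component_roots S :\: T)) = cube_antichain I S T.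
Proof.
apply/setP => x; rewrite !in_cube_antichain; congr (_ || _).
case: (boolP (x \in S)) => //= xS.
by rewrite in_setC in_setD root_component_roots // andbT negbK.
Qed.

(** * The cube of antichain pairs with given intersection and symmetric difference *)

Section Class.
Variables A0 B0 : {set P}.
Hypotheses (acA0 : is_antichain A0) (acB0 : is_antichain B0).

Let I := A0 :&: B0.
Let S := symdiff A0 B0.
Let X := component_roots S.
Let D := cube_antichain I S.

Let topN x y : x \in S -> y \in S -> (x < y)%O -> x \notin top S.
Proof.
by move=> xS yS xy; rewrite inE xS negbK; apply/exists_inP; exists y.
Qed.

(** Each point of [S] lies in exactly one of [A] and [B], and neither antichain can hold both of two
    comparable points. *)
Let lt_sides A B x y : is_antichain A -> is_antichain B ->
  pair_class (A, B) = (I, S) -> x \in S -> y \in S -> (x < y)%O ->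
  (x \in A) = (y \notin A).
Proof.
move=> /antichainP acA /antichainP acB [_ eS]; rewrite -eS !inE.
move=> xS yS xy; have xNy : x <> y by move=> e; rewrite e ltxx in xy.
have {}xy := ltW xy.
have := acA x y; have := acB x y; move: xS yS.
by case: (x \in A); case: (y \in A); case: (x \in B); case: (y \in B) => //=
   _ _ hB hA; case: xNy; by [apply: hA | apply: hB].
Qed.

(** [S] has no chain [x < y < z]: sides alternate along it, which would put [x] and [z] on the same
    side. *)
Let topP x y : x \in S -> y \in S -> (x < y)%O -> y \in top S.
Proof.
move=> xS yS xy; rewrite inE yS; apply/exists_inP => -[z zS yz].
have sides := lt_sides acA0 acB0 erefl.
have := sides _ _ xS yS xy; have := sides _ _ yS zS yz.
have := sides _ _ xS zS (lt_trans xy yz).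
by do 3 case: (_ \in _).
Qed.

Let disjIS x : x \in I -> x \notin S.
Proof. by rewrite !inE => /andP[-> ->]. Qed.

(** Points of [I] lie in both [A0] and [B0], hence are incomparable to [S]. Of two points [x < y] of
    [S], which share a root, only [y] is in [top S], so exactly one is selected. *)
Lemma cube_antichain_antichain T : is_antichain (D T).
Proof.
have acIS x y : x \in I -> y \in S -> ~~ (x >=< y)%O.
  rewrite !inE => /andP[xA xB] yS; apply/negP => cxy.
  have [C acC [xC yC xNy]] :
      exists2 C, is_antichain C & [/\ x \in C, y \in C & x <> y].
    have xNy : x <> y by move=> e; move: yS; rewrite -e xA xB.
    by case/orP: yS => /andP[_ yC]; [exists A0 | exists B0].
  move/antichainP: acC => acC; case/orP: cxy => /acC h; apply: xNy.
    exact: h.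
  exact/esym/h.
apply/antichainP => x y; rewrite !in_setU => xD yD xy; apply/eqP/negPn/negP => ne.
have lt : (x < y)%O by rewrite lt_neqAle ne.
case/orP: xD => xD; case/orP: yD => yD.
- by move: xD yD ne; rewrite !inE => /andP[xA _] /andP[yA _];
     move/antichainP: acA0 => /(_ x y xA yA xy) ->; rewrite eqxx.
- move: yD; rewrite inE => /andP[yS _].
  by move: (acIS _ _ xD yS); rewrite /Order.comparable xy.
- move: xD; rewrite inE => /andP[xS _].
  by move: (acIS _ _ yD xS); rewrite /Order.comparable xy orbT.
move: xD yD; rewrite [x \in _]inE [y \in _]inE => /andP[xS xD] /andP[yS yD].
move: xD yD; rewrite (root_lt xS yS lt) (negbTE (topN xS yS lt)) (topP xS yS lt).
by case: (_ \in T).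
Qed.

Lemma pair_class_cube T : pair_class (D T, D (~: T)) = (I, S).
Proof.
rewrite /pair_class /=; congr (_, _); apply/setP => x.
  rewrite in_setI !in_cube_antichain in_setC.
  by case: (x \in I); case: (x \in S); case: (x \in top S); case: (_ \in T).
rewrite in_setU !in_setD !in_cube_antichain in_setC; move: (@disjIS x).
by case: (x \in I); case: (x \in S) => IS; first [by move: (IS isT) |
   case: (x \in top S); case: (_ \in T)].
Qed.

(** A root is its own representative, so its membership in [D T] reveals its membership in [T]. *)
Lemma cube_antichain_inj : {in powerset X &, injective D}.
Proof.
move=> T1 T2; rewrite !inE => s1 s2 eD; apply/setP => r.
case: (boolP (r \in X)) => [|rX]; last first.
  by rewrite (contraNF (subsetP s1 r) rX) (contraNF (subsetP s2 r) rX).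
rewrite inE => /andP[rS /eqP er].
have rI : r \notin I by apply: contraL rS => /disjIS.
move/setP/(_ r): eD; rewrite !in_cube_antichain (negbTE rI) rS er /=.
by case: (r \in top S); case: (_ \in T1); case: (_ \in T2).
Qed.

Lemma cube_antichain_surj A B : is_antichain A -> is_antichain B ->
  pair_class (A, B) = (I, S) ->
  exists2 T, T \in powerset X & (A, B) = (D T, D (~: T)).
Proof.
(* Agreement of [A] with [top S] is constant on components, since both memberships flip along [<];
   [T] collects the roots where they agree. *)
move=> acA acB eAB; pose a := [pred x | (x \in A) == (x \in top S)].
have cla : closed (induced_comparability S) a.
  apply: closed_induced_comparability => x y xS yS xy.
  rewrite -!topredE /= (lt_sides acA acB eAB xS yS xy).
  by rewrite (negbTE (topN xS yS xy)) (topP xS yS xy); case: (_ \in A).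
exists [set r in X | r \in a]; first by rewrite inE; apply/subsetP => r /setIdP[].
have rootT x : x \in S ->
    (root (induced_comparability S) x \in [set r in X | r \in a]) =
    ((x \in A) == (x \in top S)).
  move=> xS; rewrite in_set root_component_roots //=.
  exact/esym/(closed_connect cla)/connect_root.
have inI x : x \in I = (x \in A) && (x \in B).
  by case: eAB => <- _; rewrite in_setI.
have inS x : x \in S = (x \in A) (+) (x \in B).
  by case: eAB => _ <-; rewrite !inE; do 2 case: (_ \in _).
congr (_, _); apply/setP => x; rewrite in_cube_antichain inI;
  case: (boolP (x \in S)) => /= [xS|]; rewrite ?in_setC ?rootT //=.
- move: xS; rewrite inS.
  by case: (x \in A); case: (x \in B); case: (x \in top S).
- by rewrite inS; case: (x \in A); case: (x \in B).
- move: xS; rewrite inS.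
  by case: (x \in A); case: (x \in B); case: (x \in top S).
- by rewrite inS; case: (x \in A); case: (x \in B).
Qed.

(** Enlarging [T] can only drop a non-maximal point of [S], and then a maximal point above it, in
    the same component, is selected. *)
Lemma downset_of_cube_mono (T T' : {set P}) : T \subset T' ->
  downset_set (downset_of (D T)) \subset downset_set (downset_of (D T')).
Proof.
move=> /subsetP sT; apply/subsetP => z /down_closureP[x xD zx].
suff /down_closureP[y yD xy] : x \in down_closure (D T').
  by apply/down_closureP; exists y => //; apply: le_trans xy.
move: xD; rewrite in_setU => /orP[xI|].
  by apply/down_closureP; exists x; rewrite // in_setU xI.
rewrite inE => /andP[xS xT]; apply/down_closureP.
case: (boolP (x \in D T')) => [|xD]; first by exists x.
have [rT' xN] : root (induced_comparability S) x \in T' /\ x \notin top S.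
  move: xD xT (sT (root (induced_comparability S) x)).
  rewrite in_cube_antichain xS negb_or => /andP[_] /=.
  case: (_ \in top S); case: (_ \in T); case: (_ \in T') => //=.
  by move=> _ _ /(_ isT).
move: xN; rewrite inE xS negbK => /exists_inP[y yS xy].
exists y; last exact: ltW.
by rewrite in_cube_antichain yS (topP xS yS xy)
  -(root_lt xS yS xy) rT' orbT.
Qed.

Variables f g : {ffun downset P -> 'I_#|{: downset P}|}.
Hypotheses (lef : is_linear_extension f) (leg : is_linear_extension g).

Lemma reversed_pairs_class :
  4 * #|[set AB in reversed_pairs f g | pair_class AB == (I, S)]| <=
  #|[set AB : {set P} * {set P} |
      [&& is_antichain AB.1, is_antichain AB.2 &
          2 <= num_components (symdiff AB.1 AB.2)] &&
      (pair_class AB == (I, S))]|.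
Proof.
pose cube T := (D T, D (~: T)).
(* As [T] grows, [D T] generates a larger downset and [D (~: T)] a smaller one, so [u] is up-closed
   and [v] down-closed. *)
pose u T := g (downset_of (D (~: T))) < g (downset_of (D T)).
pose v T := f (downset_of (D T)) < f (downset_of (D (~: T))).
set R := [set AB in _ | _].
have leR : #|R| <= #|[set T in powerset X | u T && v T]|.
  apply: leq_trans (leq_imset_card cube _); apply/subset_leq_card/subsetP.
  move=> [A B]; rewrite 2!inE => /andP[/and4P[/= acA acB ltf ltg] /eqP eAB].
  have [T TX eT] := cube_antichain_surj acA acB eAB.
  apply/imsetP; exists T => //; rewrite inE TX /u /v.
  by case: eT => <- <-; rewrite ltf ltg.
have leF : 4 * #|[set T in powerset X | u T && v T]| <= 2 ^ #|X|.
  apply: card_up_down_complement_free => [T T' sT|T T' sT|T sT|T sT].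
  - have sC : ~: T' \subset ~: T by rewrite setCS.
    rewrite /u => lt; apply: leq_trans (linext_mono leg (downset_of_cube_mono sT)).
    exact: leq_ltn_trans (linext_mono leg (downset_of_cube_mono sC)) lt.
  - have sC : ~: T' \subset ~: T by rewrite setCS.
    rewrite /v => lt; apply: leq_trans (linext_mono lef (downset_of_cube_mono sC)).
    exact: leq_ltn_trans (linext_mono lef (downset_of_cube_mono sT)) lt.
  - rewrite /u /D /X cube_antichain_setCD cube_antichain_setD -leqNgt.
    exact: ltnW.
  - rewrite /v /D /X cube_antichain_setCD cube_antichain_setD -leqNgt.
    exact: ltnW.
(* With at most one component, [2 ^ #|X| <= 2] forces [R] to be empty. Otherwise all [2 ^ #|X|]
   pairs of the cube are counted on the right. *)
have [X2|X1] := leqP 2 #|X|; last first.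
  by move: leF leR; case: #|X| X1 => [|[|//]] _; lia.
apply: leq_trans (leq_mul (leqnn 4) leR) _; apply: leq_trans leF _.
rewrite -card_powerset -(@card_in_imset _ _ cube) => [|T T' TX TX' []]; last first.
  by move=> eD _; apply: cube_antichain_inj.
apply/subset_leq_card/subsetP => _ /imsetP[T _ ->].
have := pair_class_cube T; rewrite inE => eC; rewrite eC eqxx andbT.
rewrite !cube_antichain_antichain /=; case: eC => _ ->.
by rewrite num_components_roots.
Qed.

End Class.
End AntichainDownset.

Theorem theorem3 (d : Order.disp_t) (P : finPOrderType d) :
  4 * led (downset P) <=
    #|[set AB : {set P} * {set P} |
        [&& is_antichain AB.1, is_antichain AB.2 &
            2 <= num_components (symdiff AB.1 AB.2)]]|.
Proof.
set G := [set AB | _].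
suff dist f g : is_linear_extension f -> is_linear_extension g ->
    4 * linext_dist (T := downset P) f g <= #|G|.
  (* The factor 4 becomes a division of the bound, so that the maxima can be bounded termwise. *)
  rewrite mulnC -leq_divRL //; apply/bigmax_leqP => f lef.
  apply/bigmax_leqP => g leg; rewrite leq_divRL // mulnC; exact: dist.
move=> lef leg.
apply: leq_trans (leq_mul (leqnn 4) (linext_dist_reversed_pairs f g)) _.
have card_class (F : {set {set P} * {set P}}) :
    #|F| = \sum_k #|[set AB in F | pair_class AB == k]|.
  rewrite -sum1_card (partition_big (@pair_class _ P) predT) //=.
  by apply: eq_bigr => k _; rewrite sum1dep_card.
rewrite (card_class (reversed_pairs f g)) (card_class G) big_distrr /=.
apply: leq_sum => k _.
(* A nonempty class supplies the base antichains that span its cube. *)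
have [->|/set0Pn[[A B]]] :=
  eqVneq [set AB in reversed_pairs f g | pair_class AB == k] set0.
  by rewrite cards0 muln0.
rewrite 2!inE => /andP[/and4P[/= acA acB _ _] /eqP <-].
apply: leq_trans (reversed_pairs_class acA acB lef leg) _.
by apply: subset_leq_card; apply/subsetP => AB; rewrite !inE.
Qed.
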